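(* Let $\mathcal{A}_2$ be the family consisting of the seven graphs $$K_5,\quad \overline{3K_3},\quad 2K_3\oplus\overline{K_2},\quad 2\left(\overline{2K_2}\right)\oplus\overline{K_3},\quad \overline{2K_2}\oplus(K_1+K_2),\quad \left(\overline{2K_2}+K_3\right)\oplus\overline{K_2},\quad \overline{3K_2+K_1}.$$ A cograph $G$ has vertex arboricity at most $2$ if and only if $G$ is $\mathcal{A}_2$-free, i.e. no graph in $\mathcal{A}_2$ is isomorphic to an induced subgraph of $G$.
   Context: All graphs are finite and simple. $G+H$ denotes disjoint union, $nG$ the disjoint union of $n$ copies of $G$, $G\oplus H$ the join (the disjoint union plus all edges between $G$ and $H$), and $\overline{G}$ the complement. A cograph is a graph with no induced path $P_4$ on four vertices; equivalently, a graph obtainable from $K_1$ by repeatedly applying disjoint union and complement. The vertex arboricity of a graph is the minimum $p$ such that its vertex set can be partitioned into $p$ subsets, each inducing a forest (acyclic subgraph). *)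

(* Defs.v *)
From mathcomp Require Import all_boot.
Set Implicit Arguments.
Unset Strict Implicit.
Unset Printing Implicit Defensive.

Record sgraph := SGraph {
  vertex :> finType;
  edge : rel vertex;
  edge_sym : symmetric edge;
  edge_irrefl : irreflexive edge
}.

Section Operations.
Variables (n : nat) (G H : sgraph).

Definition complete_edge : rel 'I_n := [rel x y | x != y].
Fact complete_sym : symmetric complete_edge.
Proof. by move=> x y; rewrite /complete_edge /= eq_sym. Qed.
Fact complete_irrefl : irreflexive complete_edge.
Proof. by move=> x; rewrite /complete_edge /= eqxx. Qed.
Definition complete := SGraph complete_sym complete_irrefl.

Definition path_edge : rel 'I_n := [rel x y : 'I_n | (x.+1 == y) || (y.+1 == x)].
Fact path_sym : symmetric path_edge.
Proof. by move=> x y; rewrite /path_edge /= orbC. Qed.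
Fact path_irrefl : irreflexive path_edge.
Proof. by move=> x; rewrite /path_edge /= gtn_eqF. Qed.
(* [path_graph n] has n vertices. *)
Definition path_graph := SGraph path_sym path_irrefl.

Definition compl_edge : rel G := [rel x y | (x != y) && ~~ edge x y].
Fact compl_sym : symmetric compl_edge.
Proof. by move=> x y; rewrite /compl_edge /= eq_sym edge_sym. Qed.
Fact compl_irrefl : irreflexive compl_edge.
Proof. by move=> x; rewrite /compl_edge /= eqxx. Qed.
Definition compl := SGraph compl_sym compl_irrefl.

Definition union_edge : rel (G + H)%type := fun u v =>
  match u, v with
  | inl x, inl y => edge x y
  | inr x, inr y => edge x y
  | _, _ => false
  end.
Fact union_sym : symmetric union_edge.
Proof. by case=> x [] y //=; rewrite edge_sym. Qed.
Fact union_irrefl : irreflexive union_edge.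
Proof. by case=> x /=; rewrite edge_irrefl. Qed.
Definition union := SGraph union_sym union_irrefl.

Definition join_edge : rel (G + H)%type := fun u v =>
  match u, v with
  | inl x, inl y => edge x y
  | inr x, inr y => edge x y
  | _, _ => true
  end.
Fact join_sym : symmetric join_edge.
Proof. by case=> x [] y //=; rewrite edge_sym. Qed.
Fact join_irrefl : irreflexive join_edge.
Proof. by case=> x /=; rewrite edge_irrefl. Qed.
Definition join := SGraph join_sym join_irrefl.

Definition copies_edge : rel ('I_n * G)%type :=
  [rel u v | (u.1 == v.1) && edge u.2 v.2].
Fact copies_sym : symmetric copies_edge.
Proof. by move=> u v; rewrite /copies_edge /= eq_sym edge_sym. Qed.
Fact copies_irrefl : irreflexive copies_edge.
Proof. by move=> u; rewrite /copies_edge /= edge_irrefl andbF. Qed.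
Definition copies := SGraph copies_sym copies_irrefl.

Variable A : {set G}.
Definition induced_edge : rel {x : G | x \in A} :=
  [rel x y | edge (val x) (val y)].
Fact induced_sym : symmetric induced_edge.
Proof. by move=> x y; rewrite /induced_edge /= edge_sym. Qed.
Fact induced_irrefl : irreflexive induced_edge.
Proof. by move=> x; rewrite /induced_edge /= edge_irrefl. Qed.
Definition induced := SGraph induced_sym induced_irrefl.

End Operations.

Declare Scope graph_scope.
Delimit Scope graph_scope with graph.
Bind Scope graph_scope with sgraph.
Notation "''K_' n" := (complete n)
  (at level 8, n at level 2, format "''K_' n") : graph_scope.
Notation "~` G" := (compl G) (at level 35, right associativity) : graph_scope.
Notation "G + H" := (union G H) : graph_scope.
Notation "G (+) H" := (join G H) : graph_scope.
Notation "n %: G" := (copies n G) (at level 30, right associativity)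
  : graph_scope.

Definition isomorphic (G H : sgraph) : Prop :=
  exists2 f : G -> H, bijective f & forall x y, edge (f x) (f y) = edge x y.

Definition has_induced (G H : sgraph) : Prop :=
  exists A : {set G}, isomorphic H (induced A).

Definition cograph (G : sgraph) : Prop := ~ has_induced G (path_graph 4).

Definition family_free (F : sgraph -> Prop) (G : sgraph) : Prop :=
  forall H, F H -> ~ has_induced G H.

(* A cycle has at least three vertices: [ucycleb] also accepts the empty
   sequence and, for every edge xy, the sequence [:: x; y]. Bounding the length
   by #|G| makes the predicate boolean and loses nothing, see [forestP]. *)
Definition forest (G : sgraph) : bool :=
  [forall k : 'I_#|G|.+1, forall c : k.-tuple G,
     ucycleb (@edge G) c ==> (k < 3)].

Lemma forestP (G : sgraph) :
  reflect (forall c : seq G, ucycle (@edge G) c -> size c < 3) (forest G).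
Proof.
apply: (iffP forallP) => [acyc c /andP[cc uc] | acyc k].
  have szc : size c < #|G|.+1 by rewrite ltnS -(card_uniqP uc) max_card.
  have /forallP/(_ (in_tuple c)) := acyc (Ordinal szc).
  by rewrite /ucycleb cc uc.
apply/forallP => c; apply/implyP => cc.
by rewrite -(size_tuple c); apply: acyc.
Qed.

Definition forest_partition (G : sgraph) (p : nat) : bool :=
  [exists P : {set {set G}},
     [&& partition P [set: G], #|P| == p & [forall A in P, forest (induced A)]]].

Fact forest_partition_exists (G : sgraph) : exists p, forest_partition G p.
Proof.
pose P := [set [set x] | x : G].
exists #|P|; apply/existsP; exists P; rewrite eqxx /=; apply/andP; split.
  apply/and3P; split.
  - apply/eqP/setP => x; rewrite inE; apply/bigcupP.
    by exists [set x]; rewrite ?inE // imset_f.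
  - apply/trivIsetP => _ _ /imsetP[x _ ->] /imsetP[y _ ->] xy.
    rewrite -setI_eq0; apply/eqP/setP => z; rewrite !inE.
    by apply: contraNF xy => /andP[/eqP<- /eqP<-].
  - apply/imsetP => -[x _ /setP/(_ x)].
    by rewrite !inE eqxx.
apply/forall_inP => _ /imsetP[x _ ->]; apply/forestP => c /andP[_ uc].
rewrite -(card_uniqP uc); apply: leq_ltn_trans (max_card _) _.
by rewrite card_sig; apply: (@leq_ltn_trans 1); rewrite // -(cards1 x) subset_leq_card.
Qed.

Definition vertex_arboricity (G : sgraph) : nat :=
  ex_minn (forest_partition_exists G).

Variant A2 : sgraph -> Prop :=
  | A2_1 : A2 'K_5
  | A2_2 : A2 (~` (3 %: 'K_3))
  | A2_3 : A2 ((2 %: 'K_3) (+) (~` 'K_2))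
  | A2_4 : A2 ((2 %: (~` (2 %: 'K_2))) (+) (~` 'K_3))
  | A2_5 : A2 ((~` (2 %: 'K_2)) (+) ('K_1 + 'K_2))
  | A2_6 : A2 (((~` (2 %: 'K_2)) + 'K_3) (+) (~` 'K_2))
  | A2_7 : A2 (~` ((3 %: 'K_2) + 'K_1)).

(* Main.v *)
(** A cograph with at least two vertices is a disjoint union or a join, so one
    argues by induction on vertex subsets, and only joins S (+) T matter. If
    both sides have an edge and G is free of A_2, both are K_3-free, hence
    bipartite, and either one side has two vertices, or both are forests, or C_4
    joined to P_3 or to K_1 + K_2 occurs, which is excluded. If S is stable, then T
    should be: a stable set plus a forest when |S| = 1 (the obstructions are K_4
    and K_{2,2,2}); one vertex plus a forest when |S| >= 3 (the obstructions are
    K_4, the wheel W_4, 2K_1 (+) (K_1 + K_2), 2K_3, C_4 + K_3, 2C_4 and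
    K_{3,3}); either the latter or bipartite when |S| = 2, which excuses 2C_4
    and K_{3,3}. The joins of these obstructions with S contain members of A_2.
    Conversely, a finite search shows that each two-colouring of a member of A_2
    has a monochromatic cycle of length 3 or 4. *)

Require Import Defs.
From mathcomp Require Import all_boot.
Set Implicit Arguments.
Unset Strict Implicit.
Unset Printing Implicit Defensive.

(** * Induced copies inside vertex sets *)

(** Embeddings stand in for isomorphisms onto induced subgraphs because they compose and glue.
    Confining the image to [S] lets inductions run over the vertex sets of one fixed [G]. *)
Definition contains (G : sgraph) (S : {set G}) (H : sgraph) : Prop :=
  exists f : H -> G,
    [/\ injective f, forall x y, edge (f x) (f y) = edge x y
      & forall x, f x \in S].

Definition embeds (H K : sgraph) : Prop := contains [set: K] H.

Definition nonadjacent (G : sgraph) (S T : {set G}) : Prop :=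
  forall x y, x \in S -> y \in T -> ~~ edge x y.

Definition all_adjacent (G : sgraph) (S T : {set G}) : Prop :=
  forall x y, x \in S -> y \in T -> edge x y.

Definition stable (G : sgraph) (S : {set G}) : bool :=
  [forall x in S, forall y in S, ~~ edge x y].

(** Cycles of [G] that stay in [S] stand for cycles of the induced subgraph, so no subtype is
    formed; see [forest_inducedP]. *)
Definition acyclic (G : sgraph) (S : {set G}) : Prop :=
  forall c : seq G, ucycle (@edge G) c -> {subset c <= S} -> size c < 3.

(* X and Y may overlap: the properties P and Q used here are hereditary. *)
Definition covered (G : sgraph) (P Q : {set G} -> Prop) (S : {set G}) : Prop :=
  exists X Y, [/\ S = X :|: Y, P X & Q Y].

(** An embedding corestricted to its image is an injection between types of equal size, hence a
    bijection. *)
Lemma has_inducedP (G H : sgraph) : has_induced G H <-> embeds H G.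
Proof.
split=> [[A [f [g fK gK] fE]] | [f [injf fE _]]].
  exists (val \o f); split=> //; apply: inj_comp val_inj (can_inj fK).
have fA x : f x \in [set f y | y : H] by apply: imset_f.
exists [set f y | y : H], (fun x => exist _ (f x) (fA x)); last first.
  by move=> x y; rewrite /= /induced_edge /= fE.
apply: inj_card_bij => [x y [/injf] //|].
by rewrite card_sig (eq_card (B := mem [set f y | y : H])) // card_imset.
Qed.

Lemma contains_sub (G H : sgraph) (S T : {set G}) :
  S \subset T -> contains S H -> contains T H.
Proof.
by move=> /subsetP sST [f [fi fE fS]]; exists f; split=> // x; apply: sST.
Qed.

Lemma contains_trans (G H K : sgraph) (S : {set G}) :
  embeds K H -> contains S H -> contains S K.
Proof.
move=> [g [gi gE _]] [f [fi fE fS]]; exists (f \o g); split=> //=.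
- exact: inj_comp.
- by move=> x y; rewrite fE gE.
Qed.

(** * Gluing induced copies along unions, joins and complements *)

Lemma embeds_compl (H K : sgraph) :
  embeds K H -> embeds (~` K) (~` H).
Proof.
move=> [f [fi fE _]]; exists f; split=> // x y.
by rewrite /= /compl_edge /= inj_eq // fE.
Qed.

Lemma embeds_copiesD m n (H : sgraph) :
  embeds ((m + n) %: H) (m %: H + n %: H).
Proof.
exists (fun u : 'I_(m + n) * H =>
  match split u.1 with inl i => inl (i, u.2) | inr i => inr (i, u.2) end).
split=> [[i x] [j y]|[i x] [j y]|u]; rewrite ?inE //= /copies_edge /=.
  rewrite -{2}(splitK i) -{2}(splitK j).
  by case: (split i) (split j) => [a|a] [b|b] //= [-> ->].
rewrite -(inj_eq (can_inj (@splitK m n))).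
by case: (split i) (split j) => [a|a] [b|b].
Qed.

Lemma embeds_copiesD_union m n (H K : sgraph) :
  embeds ((m + n) %: H + K) (m %: H + (n %: H + K)).
Proof.
have [f [fi fE _]] := embeds_copiesD m n H.
exists (fun u => match u with
  | inl x => match f x with inl y => inl y | inr y => inr (inl y) end
  | inr z => inr (inr z) end).
split=> [[x|x] [y|y]|[x|x] [y|y]|u]; rewrite ?inE //=.
- move=> fxy; congr inl; apply: fi.
  by case: (f x) (f y) fxy => [a|a] [b|b] // [->].
- by case: (f x).
- by case: (f y).
- by case=> ->.
- by have /= <- := fE x y; case: (f x) (f y) => [a|a] [b|b].
- by case: (f x).
- by case: (f y).
Qed.

Lemma embeds_copies1 (H : sgraph) : embeds (1 %: H) H.
Proof.
exists snd; split=> [[i x] [j y]|[i x] [j y]|u]; rewrite ?inE //.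
  by rewrite !ord1 /= => ->.
by rewrite !ord1. 
Qed.

(** Complementation turns the two copies into a join, and joins associate. For [H] equal to ['K_2]
    this assembles C_4 from two nonadjacent pairs, as [A2_5] requires. *)
Lemma embeds_join_compl_copies (H K : sgraph) :
  embeds (~` (2 %: H) (+) K) (~` H (+) (~` H (+) K)).
Proof.
exists (fun u => match u with
  | inl p => if split (p.1 : 'I_(1 + 1)) is inl _ then inl p.2
             else inr (inl p.2)
  | inr z => inr (inr z) end).
split=> [[[i x]|x] [[j y]|y]|[[i x]|x] [[j y]|y]|u]; rewrite ?inE //=.
- rewrite -{2}(splitK (i : 'I_(1 + 1))) -{2}(splitK (j : 'I_(1 + 1))).
  by case: (split _) (split _) => [a|a] [b|b] //= [->]; rewrite !ord1.
- by case: (split _).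
- by case: (split _).
- by case=> ->.
- rewrite /= /compl_edge /= /copies_edge /= xpair_eqE.
  rewrite -(inj_eq (can_inj (@splitK 1 1))).
  case: (split _) (split _) => [a|a] [b|b]; rewrite /= /compl_edge //=;
    by rewrite !ord1 eqxx.
- by case: (split _).
- by case: (split _).
Qed.

Section Constructions.
Variables (G : sgraph) (S T : {set G}).
Implicit Types H K : sgraph.

Lemma contains_join H K : all_adjacent S T ->
  contains S H -> contains T K -> contains (S :|: T) (H (+) K).
Proof.
move=> adj [f [fi fE fS]] [g [gi gE gT]].
exists (fun u => match u with inl x => f x | inr y => g y end); split.
- move=> [x|x] [y|y] => [/fi->|fg|fg|/gi->] //.
    by have := adj _ _ (fS x) (gT y); rewrite fg edge_irrefl.
  by have := adj _ _ (fS y) (gT x); rewrite fg edge_irrefl.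
- move=> [x|x] [y|y] //=; first exact: adj.
  by rewrite edge_sym; apply: adj.
- by move=> [x|x]; rewrite inE ?fS ?gT ?orbT.
Qed.

Lemma contains_union H K : [disjoint S & T] -> nonadjacent S T ->
  contains S H -> contains T K -> contains (S :|: T) (H + K).
Proof.
move=> dST nadj [f [fi fE fS]] [g [gi gE gT]].
exists (fun u => match u with inl x => f x | inr y => g y end); split.
- move=> [x|x] [y|y] => [/fi->|fg|fg|/gi->] //.
    by have := disjointFr dST (fS x); rewrite fg gT.
  by have := disjointFr dST (fS y); rewrite -fg gT.
- move=> [x|x] [y|y] //=; first exact/negbTE/nadj.
  by rewrite edge_sym; apply/negbTE/nadj.
- by move=> [x|x]; rewrite inE ?fS ?gT ?orbT.
Qed.

(** The complement of a disjoint union is the join of the complements on the same vertices, hence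
    the embedding [id]. *)
Lemma contains_compl_union H K : all_adjacent S T ->
  contains S (~` H) -> contains T (~` K) -> contains (S :|: T) (~` (H + K)).
Proof.
move=> adj cH cK; apply: contains_trans (contains_join adj cH cK).
by exists id; split=> // [[x|x] [y|y]].
Qed.

Lemma contains_complete_add m n : all_adjacent S T ->
  contains S 'K_m -> contains T 'K_n -> contains (S :|: T) 'K_(m + n).
Proof.
move=> adj cm cn; apply: contains_trans (contains_join adj cm cn).
exists (@split m n); split=> // [|i j]; first exact: can_inj (@splitK m n).
rewrite /= /complete_edge /= -(inj_eq (can_inj (@splitK m n))).
by case: (split i) (split j) => [a|a] [b|b].
Qed.

Lemma contains_copiesD m n H : [disjoint S & T] -> nonadjacent S T ->
  contains S (m %: H) -> contains T (n %: H) ->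
  contains (S :|: T) ((m + n) %: H).
Proof.
move=> dST nadj cm cn; apply: contains_trans (contains_union dST nadj cm cn).
exact: embeds_copiesD.
Qed.

Lemma contains_compl_copiesD m n H : all_adjacent S T ->
  contains S (~` (m %: H)) -> contains T (~` (n %: H)) ->
  contains (S :|: T) (~` ((m + n) %: H)).
Proof.
move=> adj cm cn; apply: contains_trans (contains_compl_union adj cm cn).
exact/embeds_compl/embeds_copiesD.
Qed.

Lemma contains_compl_copiesD_union m n H K : all_adjacent S T ->
  contains S (~` (m %: H)) -> contains T (~` (n %: H + K)) ->
  contains (S :|: T) (~` ((m + n) %: H + K)).
Proof.
move=> adj cm cn; apply: contains_trans (contains_compl_union adj cm cn).
exact/embeds_compl/embeds_copiesD_union.
Qed.

Lemma contains_copies1 H : contains S H -> contains S (1 %: H).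
Proof. exact/contains_trans/embeds_copies1. Qed.

Lemma contains_compl_copies1 H : contains S (~` H) -> contains S (~` (1 %: H)).
Proof. exact/contains_trans/embeds_compl/embeds_copies1. Qed.

Lemma contains_vertex x : x \in S -> contains S 'K_1.
Proof.
move=> xS; exists (fun _ => x); split=> // i j; rewrite !ord1 //.
by rewrite !edge_irrefl.
Qed.

Lemma contains_stable n : stable S -> n <= #|S| -> contains S (~` 'K_n).
Proof.
move=> stS leS; exists (enum_val \o widen_ord leS).
split=> [i j /enum_val_inj/(congr1 val) ij|i j|i]; last exact: enum_valP.
  exact: val_inj.
rewrite /= /compl_edge /= /complete_edge /= andbN; apply/negbTE.
have /forall_inP/(_ _ (enum_valP _))/forall_inP := stS.
by apply; apply: enum_valP.
Qed.

End Constructions.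

(** * Stable and acyclic sets *)

Section Sets.
Variable G : sgraph.
Implicit Types (S T X Y A B I : {set G}) (P Q : {set G} -> Prop).

Lemma stableP S : reflect {in S &, forall x y, ~~ edge x y} (stable S).
Proof.
apply: (iffP forall_inP) => [st x y xS yS|st x xS].
  exact: (forall_inP (st x xS)).
by apply/forall_inP=> y; apply: st.
Qed.

Lemma stable1 (x : G) : stable [set x].
Proof.
by apply/stableP=> y z; rewrite !inE => /eqP-> /eqP->; rewrite edge_irrefl.
Qed.

Lemma nonadjacent_sym S T : nonadjacent S T -> nonadjacent T S.
Proof. by move=> na x y xT yS; rewrite edge_sym na. Qed.

Lemma all_adjacent_sym S T : all_adjacent S T -> all_adjacent T S.
Proof. by move=> na x y xT yS; rewrite edge_sym na. Qed.

Lemma nonadjacent_sub S S' T T' : S' \subset S -> T' \subset T ->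
  nonadjacent S T -> nonadjacent S' T'.
Proof.
by move=> /subsetP sS /subsetP sT na x y /sS xS /sT; apply: na.
Qed.

Lemma contains_edge S x y : x \in S -> y \in S -> edge x y -> contains S 'K_2.
Proof.
move=> xS yS xy; apply: (@contains_sub _ _ ([set x] :|: [set y])).
  by apply/subsetP=> z; rewrite !inE => /orP[] /eqP->.
apply: (@contains_complete_add _ _ _ 1 1); last 2 first.
- by apply: (@contains_vertex _ _ x); rewrite inE.
- by apply: (@contains_vertex _ _ y); rewrite inE.
by move=> a b; rewrite !inE => /eqP-> /eqP->.
Qed.

Lemma stable_or_edge S : stable S \/ contains S 'K_2.
Proof.
case: (boolP (stable S)) => [|/forall_inPn [x xS /forall_inPn [y yS]]].
  by left.
by rewrite negbK => xy; right; apply: contains_edge xy.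
Qed.

Lemma stableU S T : nonadjacent S T -> stable S -> stable T -> stable (S :|: T).
Proof.
move=> na /stableP stS /stableP stT; apply/stableP=> x y.
rewrite !inE => /orP[xS|xT] /orP[yS|yT]; [exact: stS|exact: na| |exact: stT].
by rewrite edge_sym na.
Qed.

Lemma acyclic_sub S T : S \subset T -> acyclic T -> acyclic S.
Proof. by move=> /subsetP sST ac c cc cS; apply: ac cc _ => x /cS/sST. Qed.

Lemma path_nonadjacent S T x p : nonadjacent S T -> x \in S ->
  path (@edge G) x p -> {subset p <= S :|: T} -> {subset p <= S}.
Proof.
move=> na; elim: p x => [|y p IH] x xS //= /andP[xy yp] pST.
have yS : y \in S.
  have := pST y (mem_head _ _); rewrite inE => /orP[//|yT].
  by have := na _ _ xS yT; rewrite xy.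
move=> z; rewrite inE => /orP[/eqP-> //|]; apply: IH yS yp _ z => w wp.
by apply: pST; rewrite inE wp orbT.
Qed.

(** By [path_nonadjacent], a cycle cannot leave the side of its first vertex. *)
Lemma acyclicU S T :
  nonadjacent S T -> acyclic S -> acyclic T -> acyclic (S :|: T).
Proof.
wlog suff wl : S T / nonadjacent S T -> acyclic S -> forall x p,
    ucycle (@edge G) (x :: p) -> {subset x :: p <= S :|: T} -> x \in S ->
    size (x :: p) < 3.
  move=> na acS acT [//|x p] cxp sxp.
  have := sxp x (mem_head _ _); rewrite inE => /orP[xS|xT].
    exact: (wl S T).
  apply: (wl T S) => //; first exact: nonadjacent_sym.
  by rewrite setUC.
move=> na acS x p /[dup] cxp /andP[cyc _] sxp xS; apply: acS => //.
move=> z; rewrite inE => /orP[/eqP-> //|zp].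
apply: (path_nonadjacent na xS cyc) => [w|]; rewrite mem_rcons.
  exact: sxp.
by rewrite inE zp orbT.
Qed.

(** Every edge inside the star passes through [v], while three consecutive edges of a cycle have no
    common vertex. *)
Lemma acyclic_star v I : stable I -> acyclic (v |: I).
Proof.
move=> /stableP st [//|x [//|y [//|z p]]] /andP[cyc un] sub; exfalso.
have subI w : w \in [:: x, y, z & p] -> w != v -> w \in I.
  by move=> /sub; rewrite !inE => /orP[->|].
have noedge a b : a \in [:: x, y, z & p] -> b \in [:: x, y, z & p] ->
    edge a b -> (a == v) || (b == v).
  move=> ac bc; apply: contraTT; rewrite negb_or => /andP[av bv].
  by apply: st; apply: subI.
(* [w] follows [z] on the cycle: it is [x] in a triangle and the head of [p] otherwise. *)
have : exists2 w, w \in x :: p & edge z w.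
  case: p cyc {un sub subI noedge} => [|w p] /=.
    by case/and4P=> _ _ zx _; exists x; rewrite ?mem_head.
  by case/and4P=> _ _ zw _; exists w; rewrite // !inE eqxx orbT.
case=> w wxp zw; move: cyc un => /= /and3P[xy yz _].
have wc : w \in [:: x, y, z & p].
  by move: wxp; rewrite !inE => /orP[->|->]; rewrite ?orbT.
have [xc yc zc] : [/\ x \in [:: x, y, z & p], y \in [:: x, y, z & p]
    & z \in [:: x, y, z & p]] by rewrite !inE !eqxx !orbT.
have [xyv yzv zwv] := And3 (noedge x y xc yc xy) (noedge y z yc zc yz)
  (noedge z w zc wc zw).
rewrite !inE !negb_or => /and4P[/and3P[xney xnez xp] /andP[ynez yp] zp _].
case/orP: yzv => /eqP E; subst v.
  move: zwv; rewrite (eq_sym z) (negbTE ynez) /= => /eqP E; subst w.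
  by move: wxp; rewrite !inE eq_sym (negbTE xney) (negbTE yp).
by move: xyv; rewrite (negbTE xnez) (negbTE ynez).
Qed.

End Sets.

(** * Disconnection of a cograph or of its complement *)

(** Pointwise absence of an induced P_4. Tuples with a repeated vertex satisfy it automatically, so
    no distinctness is imposed. *)
Definition P4_free (G : sgraph) : Prop :=
  forall a b c d : G, edge a b -> edge b c -> edge c d ->
    ~~ edge a c -> ~~ edge b d -> edge a d.

(** Disconnectedness of the subgraph induced by [S], witnessed by a cut. *)
Definition splits (G : sgraph) (S : {set G}) : Prop :=
  exists A B, [/\ S = A :|: B, A != set0, B != set0, [disjoint A & B]
                & nonadjacent A B].

Lemma edge_neq (H : sgraph) (x y : H) : edge x y -> x != y.
Proof. by apply: contraTneq => ->; rewrite edge_irrefl. Qed.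

Lemma cograph_P4_free (G : sgraph) : cograph G -> P4_free G.
Proof.
move=> hG a b c d ab bc cd nac nbd; apply: contraT => nad; exfalso; apply: hG.
apply/has_inducedP; exists (fun i : 'I_4 => nth a [:: a; b; c; d] i).
have ac : a != c by apply: contraNneq nad => ->.
have bd : b != d by apply: contraNneq nad => <-.
have ad : a != d by apply: contraNneq nac => ->; rewrite edge_sym.
have un : uniq [:: a; b; c; d].
  rewrite /= !inE !negb_or (edge_neq ab) (edge_neq bc) (edge_neq cd).
  by rewrite ac bd ad.
split=> [i j /eqP|i j|i]; last by rewrite inE.
  by rewrite nth_uniq // => /eqP/val_inj.
case: i => [[|[|[|[|i]]]] //= Hi]; case: j => [[|[|[|[|j]]]] //= Hj];
  rewrite /path_edge /= ?edge_irrefl //;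
  rewrite ?(negbTE nac) ?(negbTE nbd) ?(negbTE nad) //;
  by rewrite edge_sym // ?(negbTE nac) ?(negbTE nbd) ?(negbTE nad).
Qed.

(** P_4 is self-complementary: a path a, b, c, d of the complement reads b, d, a, c in [G]. *)
Lemma P4_free_compl (G : sgraph) : P4_free G -> P4_free (~` G).
Proof.
move=> fG a b c d /andP[ab nab] /andP[bc nbc] /andP[cd ncd].
rewrite /= /compl_edge /= !negb_and !negbK => ac bd.
have [E|nad] := eqVneq a d.
  by move: ac; rewrite E (eq_sym d) (negbTE cd) edge_sym (negbTE ncd).
case/orP: ac => [/eqP->//|ac]; case/orP: bd => [/eqP E|bd].
  by rewrite -E nab.
apply/negP => ad; move/negP: nbc; apply.
by apply: (fG b d a c); rewrite // 1?edge_sym.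
Qed.

(** If [x] misses some [w], then either the side of the cut without [w] stays separated, or the
    non-neighbours of [x] on the side of [w] do. *)
Lemma splits_add (G : sgraph) (x : G) (T : {set G}) : P4_free G ->
  x \notin T -> splits T -> splits (x |: T) \/ {in T, forall y, edge x y}.
Proof.
move=> fG xT [A [B [defT A0 B0 dAB na]]].
case: (boolP [forall y in T, edge x y]) => [/forall_inP|]; first by right.
rewrite negb_forall_in => /exists_inP[w wT nxw]; left.
wlog wA : A B defT A0 B0 dAB na / w \in A.
  move=> wl; move: (wT); rewrite {1}defT inE => /orP[wA|wB].
    exact: (wl A B).
  by apply: (wl B A); rewrite 1?setUC 1?disjoint_sym //; apply: nonadjacent_sym.
have xA : x \notin A by apply: contra xT; rewrite defT inE => ->.
have xB : x \notin B by apply: contra xT; rewrite defT inE => ->; rewrite orbT.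
case: (boolP [exists z in B, edge x z]) => [/exists_inP[z zB xz]|]; last first.
  rewrite negb_exists_in => /forall_inP nxB; exists (x |: A), B; split=> //.
  - by rewrite defT setUA.
  - by apply/set0Pn; exists x; rewrite !inE eqxx.
  - by rewrite disjoints_subset subUset sub1set inE xB -disjoints_subset.
  - by move=> a b; rewrite !inE => /orP[/eqP->|/na]; [apply: nxB|apply].
(* An edge from [a] in [N] to a neighbour [y] of [x] in [A] would make a, y, x, z an induced
   path. *)
pose N := [set y in A | ~~ edge x y].
have sNA : N \subset A by apply/subsetP=> y; rewrite inE => /andP[].
exists N, (x |: (T :\: N)); split.
- rewrite setUCA; congr (_ |: _); apply/setP=> y; rewrite !inE.
  by rewrite defT !inE; case: (y \in A) (y \in B) (edge x y) => [] [] [].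
- by apply/set0Pn; exists w; rewrite inE wA.
- by apply/set0Pn; exists x; rewrite !inE eqxx.
- rewrite disjoint_sym disjoints_subset subUset sub1set !inE (negbTE xA) /=.
  by apply/subsetP=> y; rewrite !inE => /andP[].
move=> a y; rewrite inE => /andP[aA nxa].
rewrite !inE => /orP[/eqP->|]; first by rewrite edge_sym.
rewrite defT inE negb_and negbK => /andP[ynN /orP[yA|]]; last exact: na.
have xy : edge x y by move: ynN; rewrite yA.
apply/negP=> ay; suff : edge a z by apply/negP/na.
by apply: (fG a y x z) => //; [rewrite edge_sym|rewrite edge_sym|apply: na].
Qed.

Lemma splits_compl_add (G : sgraph) (x : G) (T : {set G}) :
  x \notin T -> T != set0 -> {in T, forall y, edge x y} ->
  splits (x |: T : {set compl G}).
Proof.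
move=> xT T0 adj; exists ([set x] : {set compl G}), T; split=> //.
- by apply/set0Pn; exists x; rewrite inE.
- by rewrite disjoints1.
move=> a b; rewrite inE => /eqP-> /adj /= xb.
by rewrite /compl_edge /= xb andbF.
Qed.

(** Vertices are added one at a time, and [splits_add] is used in whichever of [G] and its
    complement the remainder is disconnected. A new vertex adjacent there to all others is isolated
    in the other graph. *)
Lemma P4_free_splits (G : sgraph) (S : {set G}) : P4_free G -> 1 < #|S| ->
  splits S \/ splits (S : {set compl G}).
Proof.
move=> fG; have [n] := ubnP #|S|; elim: n S => // n IH S leS S2.
have [x xS] : exists x, x \in S by apply/card_gt0P/ltnW.
have defS := setD1K xS; have xT : x \notin S :\ x by rewrite !inE eqxx.
have cT : #|S| = #|S :\ x|.+1 by rewrite (cardsD1 x) xS.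
have T0 : S :\ x != set0 by rewrite -card_gt0 -ltnS -cT.
have [T2|] := ltnP 1 #|S :\ x|; last first.
  rewrite leq_eqVlt ltnS leqn0 cards_eq0 (negbTE T0) orbF => /cards1P[y defT].
  rewrite -defS defT; rewrite defT in xT T0.
  have [xy|nxy] := boolP (edge x y).
    by right; apply: splits_compl_add => // z; rewrite inE => /eqP->.
  left; exists [set x], [set y]; split=> //.
  - by apply/set0Pn; exists x; rewrite inE.
  - by rewrite disjoints1.
  - by move=> a b; rewrite !inE => /eqP-> /eqP->.
rewrite -defS; have [||sT|sT] := IH (S :\ x) => //; first by rewrite -ltnS -cT.
  by have [|] := splits_add fG xT sT; [left|right; apply: splits_compl_add].
have [|adj] := splits_add (P4_free_compl fG) xT sT; first by right.
left; exists [set x], (S :\ x); split=> //.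
- by apply/set0Pn; exists x; rewrite inE.
- by rewrite disjoints1.
by move=> a b; rewrite inE => /eqP-> /adj /andP[].
Qed.

(** The cut from [P4_free_splits] is a disjoint union in [G] or, when taken in the complement, a
    join. *)
Lemma cograph_ind (G : sgraph) (P : {set G} -> Prop) : cograph G ->
  P set0 -> (forall x, P [set x]) ->
  (forall S T, S != set0 -> T != set0 -> [disjoint S & T] ->
     nonadjacent S T -> P S -> P T -> P (S :|: T)) ->
  (forall S T, S != set0 -> T != set0 -> all_adjacent S T ->
     P S -> P T -> P (S :|: T)) ->
  forall S, P S.
Proof.
move=> /cograph_P4_free fG P0 P1 PU PJ S.
have [n] := ubnP #|S|; elim: n S => // n IH S leS.
have [S2|] := ltnP 1 #|S|; last first.
  rewrite leq_eqVlt ltnS leqn0 cards_eq0 => /orP[/cards1P[x ->]|/eqP->] //.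
(* Both parts of a cut are nonempty and disjoint, hence strictly smaller than [S]. *)
have cU (A B : {set G}) : S = A :|: B -> A != set0 -> B != set0 ->
    [disjoint A & B] -> P A /\ P B.
  move=> defS; rewrite -!card_gt0 => A0 B0 dAB.
  have cS : #|S| = #|A| + #|B|.
    by apply/eqP; rewrite defS (leq_card_setU A B).2.
  split; apply: IH; rewrite cS ltnS in leS; apply: leq_trans leS.
    by rewrite -addn1 leq_add2l.
  by rewrite -add1n leq_add2r.
have [|] := P4_free_splits fG S2 => -[A [B [defS A0 B0 dAB na]]].
  by have [PA PB] := cU A B defS A0 B0 dAB; rewrite defS; apply: PU.
have [PA PB] := cU A B defS A0 B0 dAB; rewrite defS; apply: PJ => // x y xA yB.
have := na x y xA yB; rewrite /= /compl_edge /= negb_and !negbK.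
by case: eqP => // E; have := disjointFr dAB xA; rewrite E yB.
Qed.

(** * Two-part covers and small induced subgraphs *)

Notation C4 := (~` (2 %: 'K_2))%graph.

Definition bipartite (G : sgraph) : {set G} -> Prop :=
  covered (fun X => stable X) (fun Y => stable Y).

(** These are the near-bipartite sets. *)
Definition stable_acyclic (G : sgraph) : {set G} -> Prop :=
  covered (fun X => stable X) (@acyclic G).

Definition biacyclic (G : sgraph) : {set G} -> Prop :=
  covered (@acyclic G) (@acyclic G).

(** These are the sets with a feedback vertex set of at most one vertex. *)
Definition apex_acyclic (G : sgraph) : {set G} -> Prop :=
  covered (fun X => #|X| <= 1) (@acyclic G).

Section SmallSubgraphs.
Variable G : sgraph.
Implicit Types (S T X Y : {set G}).

Lemma stable_set0 : stable (set0 : {set G}).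
Proof. by apply/stableP=> x y; rewrite inE. Qed.

Lemma acyclic_stable S : stable S -> acyclic S.
Proof.
move=> st [//|x c] cc cS; apply: (@acyclic_star _ x S st _ cc) => y /cS yS.
by rewrite inE yS orbT.
Qed.

Lemma coveredU (P Q : {set G} -> Prop) S T : nonadjacent S T ->
  (forall X Y, nonadjacent X Y -> P X -> P Y -> P (X :|: Y)) ->
  (forall X Y, nonadjacent X Y -> Q X -> Q Y -> Q (X :|: Y)) ->
  covered P Q S -> covered P Q T -> covered P Q (S :|: T).
Proof.
move=> na PU QU [X [Y [defS PX QY]]] [X' [Y' [defT PX' QY']]].
exists (X :|: X'), (Y :|: Y'); rewrite setUACA -defS -defT; split=> //.
  by apply: PU => //; apply: nonadjacent_sub na; rewrite ?defS ?defT subsetUl.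
by apply: QU => //; apply: nonadjacent_sub na; rewrite ?defS ?defT subsetUr.
Qed.

Lemma contains_nonempty S : S != set0 -> contains S 'K_1.
Proof. by case/set0Pn=> x; apply: contains_vertex. Qed.

Lemma contains_compl_nonempty S : S != set0 -> contains S (~` 'K_1).
Proof.
case/set0Pn=> x xS; apply: (@contains_sub _ _ [set x]).
  by rewrite sub1set.
by apply: contains_stable; rewrite ?stable1 ?cards1.
Qed.

Lemma contains_K3 S T : all_adjacent S T -> contains S 'K_2 -> T != set0 ->
  contains (S :|: T) 'K_3.
Proof.
move=> adj S2 T0; apply: (@contains_complete_add _ _ _ 2 1) => //.
exact: contains_nonempty.
Qed.

Lemma contains_K4 S T : all_adjacent S T -> contains S 'K_3 -> T != set0 ->
  contains (S :|: T) 'K_4.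
Proof.
move=> adj S2 T0; apply: (@contains_complete_add _ _ _ 3 1) => //.
exact: contains_nonempty.
Qed.

Lemma contains_C4 S T : all_adjacent S T ->
  contains S (~` 'K_2) -> contains T (~` 'K_2) -> contains (S :|: T) C4.
Proof.
move=> adj cS cT; apply: (@contains_compl_copiesD _ _ _ 1 1) => //.
  exact: contains_compl_copies1.
exact: contains_compl_copies1.
Qed.

(** A vertex off an edge sees both of its ends, one or none. P_3 is written as the complement of K_2
    + K_1 so that it merges with other complements of copies of K_2. *)
Lemma contains_three_vertices S : contains S 'K_2 -> 2 < #|S| ->
  [\/ contains S 'K_3, contains S (~` (1 %: 'K_2 + 'K_1))
    | contains S ('K_1 + 'K_2)].
Proof.
move=> [f [fi fE fS]] S3; set x := f ord0; set y := f ord_max.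
have xy : edge x y by rewrite fE.
have xS : x \in S := fS _; have yS : y \in S := fS _.
have xy_neq : x != y by rewrite (inj_eq fi).
have [z zS] : exists2 z, z \in S & z \notin [set x; y].
  have /subsetPn[z] : ~~ (S \subset [set x; y]).
    by apply: contraTN S3 => /subset_leq_card; rewrite cards2 xy_neq -leqNgt.
  by exists z.
rewrite !inE negb_or => /andP[zx zy].
have sub2 a b : a \in S -> b \in S -> [set a; b] \subset S.
  by move=> aS bS; rewrite subUset !sub1set aS bS.
have adj2 a b c : edge c a -> edge c b -> all_adjacent [set a; b] [set c].
  move=> ca cb u v; rewrite !inE => /orP[] /eqP-> /eqP->; by rewrite edge_sym.
have path3 a b c : a \in S -> b \in S -> c \in S -> a != b -> edge c a ->
    edge c b -> ~~ edge a b -> contains S (~` (1 %: 'K_2 + 'K_1)).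
  move=> aS bS cS ab ca cb nab.
  apply: (@contains_sub _ _ ([set a; b] :|: [set c])).
    by rewrite subUset sub2 // sub1set.
  apply: contains_compl_union; first exact: adj2.
    apply: contains_compl_copies1.
    apply: contains_stable; last by rewrite cards2 ab.
    apply: stableU (stable1 _) (stable1 _) => u v.
    by rewrite !inE => /eqP-> /eqP->.
  by apply: contains_compl_nonempty; apply/set0Pn; exists c; rewrite inE.
have [xz|nxz] := boolP (edge x z); have [yz|nyz] := boolP (edge y z).
- apply: Or31; apply: (@contains_sub _ _ ([set x; y] :|: [set z])).
    by rewrite subUset sub2 // sub1set.
  apply: contains_K3; first by apply: adj2; rewrite edge_sym.
    by apply: (contains_edge _ _ xy); rewrite !inE eqxx ?orbT.
  by apply/set0Pn; exists z; rewrite inE.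
- by apply: Or32; apply: (path3 y z x) => //; rewrite eq_sym.
- by apply: Or32; apply: (path3 x z y); rewrite // 1?eq_sym // edge_sym.
apply: Or33; apply: (@contains_sub _ _ ([set z] :|: [set x; y])).
  by rewrite subUset sub2 // sub1set zS.
apply: contains_union.
- by rewrite disjoints1 !inE negb_or zx zy.
- by move=> u v; rewrite !inE => /eqP-> /orP[] /eqP->; rewrite edge_sym.
- by apply: contains_nonempty; apply/set0Pn; exists z; rewrite inE.
by apply: (contains_edge _ _ xy); rewrite !inE eqxx ?orbT.
Qed.

Lemma card_split S : S != set0 -> (exists x, S = [set x]) \/ 1 < #|S|.
Proof.
rewrite -card_gt0 leq_eqVlt => /orP[/eqP/esym/eqP/cards1P|]; by [left|right].
Qed.

End SmallSubgraphs.

(** * Obstructions to covers of cographs *)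

Section Cographs.
Variable G : sgraph.
Hypothesis hG : cograph G.
Implicit Types (S T X Y : {set G}).

(** A join without K_3 has two stable sides; without C_4, one of them is a single vertex and the
    join is a star. *)
Lemma cograph_acyclic S :
  [\/ acyclic S, contains S 'K_3 | contains S C4].
Proof.
move: S; apply: (cograph_ind hG) => [|x|S T _ _ _ na IHS IHT|S T S0 T0 adj _ _].
- exact/Or31/acyclic_stable/stable_set0.
- exact/Or31/acyclic_stable/stable1.
- case: IHS => [acS|c|c].
  + case: IHT => [acT|c|c]; first exact/Or31/acyclicU.
      exact/Or32/(contains_sub _ c)/subsetUr.
    exact/Or33/(contains_sub _ c)/subsetUr.
  + exact/Or32/(contains_sub _ c)/subsetUl.
  + exact/Or33/(contains_sub _ c)/subsetUl.
have [stS|eS] := stable_or_edge S; last exact/Or32/contains_K3.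
have [stT|eT] := stable_or_edge T; last first.
  apply: Or32; rewrite setUC.
  by apply: contains_K3 => //; apply: all_adjacent_sym.
have [[x ->]|S2] := card_split S0; first exact/Or31/acyclic_star.
have [[x ->]|T2] := card_split T0.
  by apply: Or31; rewrite setUC; apply: acyclic_star.
by apply: Or33; apply: contains_C4 => //; apply: contains_stable.
Qed.

Lemma cograph_bipartite S : bipartite S \/ contains S 'K_3.
Proof.
move: S; apply: (cograph_ind hG) => [|x|S T _ _ _ na IHS IHT|S T S0 T0 adj _ _].
- by left; exists set0, set0; rewrite setU0; split=> //; apply: stable_set0.
- left; exists [set x], set0; rewrite setU0.
  by split; rewrite ?stable1 ?stable_set0.
- case: IHS => [bS|c]; last by right; apply: contains_sub c; apply: subsetUl.
  case: IHT => [bT|c]; last by right; apply: contains_sub c; apply: subsetUr.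
  by left; apply: coveredU na _ _ bS bT => X Y; apply: stableU.
have [stS|eS] := stable_or_edge S; last by right; apply: contains_K3.
have [stT|eT] := stable_or_edge T; first by left; exists S, T.
by right; rewrite setUC; apply: contains_K3 => //; apply: all_adjacent_sym.
Qed.

(** [T] is the stable part: a triangle of [S] extends by a vertex of [T] to K_4, and a C_4 of [S] by
    two vertices of [T] to K_{2,2,2}. *)
Lemma join_stable_acyclic S T : all_adjacent S T -> T != set0 -> 1 < #|T| ->
  stable T -> ~ contains (S :|: T) 'K_4 ->
  ~ contains (S :|: T) (~` (3 %: 'K_2)) ->
  stable_acyclic (S :|: T).
Proof.
move=> adj T0 T2 stT noK4 noK222; exists T, S; split=> //; first exact: setUC.
case: (cograph_acyclic S) => // [c|c]; first by case: noK4; apply: contains_K4.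
case: noK222; apply: (@contains_compl_copiesD _ _ _ 2 1) => //.
exact/contains_compl_copies1/contains_stable.
Qed.

(** Without K_4 the base [S] is triangle-free, hence bipartite, and [x] turns one of its classes
    into a star. *)
Lemma cone_stable_acyclic S x : all_adjacent S [set x] ->
  ~ contains (S :|: [set x]) 'K_4 -> stable_acyclic (S :|: [set x]).
Proof.
move=> adj noK4; have [|c] := cograph_bipartite S; last first.
  case: noK4; apply: contains_K4 => //; apply/set0Pn; exists x.
  by rewrite inE.
move=> [X [Y [defS stX stY]]]; exists X, (x |: Y).
by split=> //; [rewrite defS setUC setUCA | apply: acyclic_star].
Qed.

Lemma cograph_stable_acyclic S : ~ contains S 'K_4 ->
  ~ contains S (~` (3 %: 'K_2)) -> stable_acyclic S.
Proof.
move: S; apply: (cograph_ind hG)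
  => [|x|S T _ _ _ na IHS IHT|S T S0 T0 adj _ _] noK4 noK222.
- exists set0, set0; rewrite setU0; split=> //; first exact: stable_set0.
  exact/acyclic_stable/stable_set0.
- exists set0, [set x]; rewrite set0U; split=> //; first exact: stable_set0.
  exact/acyclic_stable/stable1.
- apply: coveredU na _ _ (IHS _ _) (IHT _ _) => [X Y|X Y| | | |].
  + exact: stableU.
  + exact: acyclicU.
  + by apply: contra_not noK4; apply: contains_sub; apply: subsetUl.
  + by apply: contra_not noK222; apply: contains_sub; apply: subsetUl.
  + by apply: contra_not noK4; apply: contains_sub; apply: subsetUr.
  + by apply: contra_not noK222; apply: contains_sub; apply: subsetUr.
have [[x E]|T2] := card_split T0.
  by rewrite E in adj noK4 *; apply: cone_stable_acyclic.
have [stT|eT] := stable_or_edge T; first exact: join_stable_acyclic.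
have adj' := all_adjacent_sym adj; rewrite setUC in noK4 noK222 *.
have [[x E]|S2] := card_split S0.
  by rewrite E in adj' noK4 *; apply: cone_stable_acyclic.
have [stS|eS] := stable_or_edge S; first exact: join_stable_acyclic.
by case: noK4; apply: (@contains_complete_add _ _ _ 2 2).
Qed.

Lemma acyclic_almost_stable S T : #|S| <= 1 -> stable T -> acyclic (S :|: T).
Proof.
have [->|/card_split[[x ->]|] //] := eqVneq S set0.
- by rewrite set0U => _; apply: acyclic_stable.
- by move=> _; apply: acyclic_star.
by rewrite ltnNge => /negbTE->.
Qed.

(** One vertex of [S] is the apex; the other, if any, is the centre of a star over [T]. *)
Lemma pair_apex_acyclic S T : #|S| <= 2 -> stable T -> apex_acyclic (S :|: T).
Proof.
have [->|/set0Pn[x xS]] := eqVneq S set0 => S2 stT.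
  by exists set0, T; rewrite cards0; split=> //; apply: acyclic_stable.
exists [set x], (S :\ x :|: T); split; first by rewrite setUA setD1K.
  by rewrite cards1.
by apply: acyclic_almost_stable => //; rewrite (cardsD1 x) xS in S2.
Qed.

(** The excluded graphs are K_4, the wheel W_4 and 2K_1 joined to K_1 + K_2. If [T] is stable with
    at least two vertices and [S] has at least three, an edge in [S] produces one of them; with both
    sides stable, only K_{3,3} remains as an obstruction. *)
Lemma join_apex_acyclic S T : S != set0 -> T != set0 -> all_adjacent S T ->
  ~ contains (S :|: T) 'K_4 -> ~ contains (S :|: T) (~` (2 %: 'K_2 + 'K_1)) ->
  ~ contains (S :|: T) (~` 'K_2 (+) ('K_1 + 'K_2)) ->
  apex_acyclic (S :|: T) \/
    bipartite (S :|: T) /\ contains (S :|: T) (~` (2 %: 'K_3)).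
Proof.
wlog : S T / stable T.
  move=> wl S0 T0 adj noK4 noW4 noF.
  have [stT|eT] := stable_or_edge T; first exact: wl.
  have [stS|eS] := stable_or_edge S; last first.
    by case: noK4; apply: (@contains_complete_add _ _ _ 2 2).
  by rewrite setUC in noK4 noW4 noF *; apply: wl => //; apply: all_adjacent_sym.
move=> stT S0 T0 adj noK4 noW4 noF; have adj' := all_adjacent_sym adj.
have [[x E]|T2] := card_split T0.
  left; exists T, S; split; [exact: setUC|by rewrite E cards1|].
  case: (cograph_acyclic S) => // c; first by case: noK4; apply: contains_K4.
  case: noW4; apply: contains_compl_union => //.
  exact: contains_compl_nonempty.
have [S2|S3] := leqP #|S| 2; first by left; apply: pair_apex_acyclic.
have cT : contains T (~` 'K_2) by apply: contains_stable.
have [stS|eS] := stable_or_edge S; last first.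
  have [c|c|c] := contains_three_vertices eS S3.
  - by case: noK4; apply: contains_K4.
  - case: noW4; rewrite setUC.
    apply: (@contains_compl_copiesD_union _ _ _ 1 1) => //.
    exact: contains_compl_copies1.
  - by case: noF; rewrite setUC; apply: contains_join.
have [T2'|T3] := leqP #|T| 2.
  by left; rewrite setUC; apply: pair_apex_acyclic.
right; split; first by exists S, T.
apply: (@contains_compl_copiesD _ _ _ 1 1) => //.
  exact/contains_compl_copies1/contains_stable.
exact/contains_compl_copies1/contains_stable.
Qed.

(** The bipartite alternative keeps its induced 2C_4 or K_{3,3}, so that a join with three
    independent vertices can be refuted in [join_biacyclic]. *)
Definition apex_or_bipartite S : Prop :=
  apex_acyclic S \/
    bipartite S /\ (contains S (2 %: C4) \/ contains S (~` (2 %: 'K_3))).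

Lemma acyclic_K3 S : acyclic S -> ~ contains S 'K_3.
Proof.
move=> acS [f [fi fE fS]].
have : size (map f [:: ord0; lift ord0 ord0; ord_max]) < 3.
  apply: acS => [|x /mapP[i _ ->]] //.
  by rewrite /ucycle map_inj_uniq //= !fE.
by [].
Qed.

Lemma acyclicU_apex_or_bipartite S T : nonadjacent S T -> acyclic S ->
  apex_or_bipartite T -> apex_or_bipartite (S :|: T).
Proof.
move=> na acS [[X [Y [defT X1 acY]]]|[bT cT]].
  left; exists X, (S :|: Y); rewrite defT setUCA; split=> //.
  by apply: acyclicU => //; apply: nonadjacent_sub na; rewrite ?defT ?subsetUr.
have [bS|/(acyclic_K3 acS)//] := cograph_bipartite S.
right; split; first by apply: coveredU na _ _ bS bT => X Y; apply: stableU.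
by case: cT => c; [left|right]; apply: contains_sub c; apply: subsetUr.
Qed.

(** In a disjoint union with a cycle on each side, each side contains K_3 or C_4, and only two
    copies of C_4 escape the exclusions. *)
Lemma cograph_apex_or_bipartite S :
  ~ contains S 'K_4 -> ~ contains S (~` (2 %: 'K_2 + 'K_1)) ->
  ~ contains S (~` 'K_2 (+) ('K_1 + 'K_2)) ->
  ~ contains S (2 %: 'K_3) -> ~ contains S (C4 + 'K_3) ->
  apex_or_bipartite S.
Proof.
move: S; apply: (cograph_ind hG)
  => [|x|S T _ _ dST na IHS IHT|S T S0 T0 adj _ _].
- move=> *; left; exists set0, set0; rewrite setU0 cards0; split=> //.
  exact/acyclic_stable/stable_set0.
- move=> *; left; exists set0, [set x]; rewrite set0U cards0; split=> //.
  exact/acyclic_stable/stable1.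
- have na' := nonadjacent_sym na.
  have dTS : [disjoint T & S] by rewrite disjoint_sym.
  move=> noK4 noW4 noF no2K3 noC4K3.
  have noS H : ~ contains (S :|: T) H -> ~ contains S H.
    by apply: contra_not; apply: contains_sub; apply: subsetUl.
  have noT H : ~ contains (S :|: T) H -> ~ contains T H.
    by apply: contra_not; apply: contains_sub; apply: subsetUr.
  have DS : apex_or_bipartite S by apply: IHS; apply: noS.
  have DT : apex_or_bipartite T by apply: IHT; apply: noT.
  have [acS|cS|cS] := cograph_acyclic S.
  + exact: acyclicU_apex_or_bipartite.
  + have [acT|cT|cT] := cograph_acyclic T.
    * by rewrite setUC; apply: acyclicU_apex_or_bipartite.
    * case: no2K3; apply: (@contains_copiesD _ _ _ 1 1) => //;
        exact: contains_copies1.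
    * by case: noC4K3; rewrite setUC; apply: contains_union.
  have [acT|cT|cT] := cograph_acyclic T.
  + by rewrite setUC; apply: acyclicU_apex_or_bipartite.
  + by case: noC4K3; apply: contains_union.
  (* Each side contains C_4 here, so a triangle on either side would give C_4 + K_3. *)
  have [bS|c] := cograph_bipartite S; last first.
    by case: noC4K3; rewrite setUC; apply: contains_union.
  have [bT|c] := cograph_bipartite T; last first.
    by case: noC4K3; apply: contains_union.
  right; split; first by apply: coveredU na _ _ bS bT => X Y; apply: stableU.
  by left; apply: (@contains_copiesD _ _ _ 1 1) => //; apply: contains_copies1.
move=> noK4 noW4 noF _ _.
have [|[bST c]] := join_apex_acyclic S0 T0 adj noK4 noW4 noF; first by left.
by right; split=> //; right.
Qed.

(** * Covering joins by two forests *)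

(** Each vertex of [S] is the centre of a star over one colour class of [T]. *)
Lemma pair_biacyclic S T : #|S| <= 2 -> bipartite T -> biacyclic (S :|: T).
Proof.
move=> S2 [X [Y [-> stX stY]]].
have [Z [W [defSY Z1 acW]]] := pair_apex_acyclic S2 stY.
exists (Z :|: X), W; rewrite setUCA defSY setUA (setUC X); split=> //.
exact: acyclic_almost_stable.
Qed.

(** A single vertex [S] forms a star with the stable part of [T]; a larger [S] forms one with the
    apex of [T]. When [T] is merely bipartite, [S] has to be a pair. *)
Lemma join_biacyclic S T : S != set0 -> T != set0 -> all_adjacent S T ->
  stable S -> (forall H, A2 H -> ~ contains (S :|: T) H) -> biacyclic (S :|: T).
Proof.
move=> S0 T0 adj stS free; have adj' := all_adjacent_sym adj.
have [[x E]|S2] := card_split S0.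
  have [c|c|X [Y [defT stX acY]]] := @cograph_stable_acyclic T.
  - apply: (free _ A2_1); apply: (@contains_complete_add _ _ _ 1 4) => //.
    exact: contains_nonempty.
  (* K_{2,2,2} joined to a vertex is the complement of 3K_2 + K_1. *)
  - apply: (free _ A2_7); rewrite setUC; apply: contains_compl_union => //.
    exact: contains_compl_nonempty.
  exists (S :|: X), Y; rewrite -setUA -defT; split=> //.
  by rewrite E; apply: acyclic_star.
have cS : contains S (~` 'K_2) by apply: contains_stable.
have [c|c|c|c|c|[X [Y [defT X1 acY]]]|[bT c]] := @cograph_apex_or_bipartite T.
- apply: (free _ A2_1); apply: (@contains_complete_add _ _ _ 1 4) => //.
  exact: contains_nonempty.
- apply: (free _ A2_7); apply: (@contains_compl_copiesD_union _ _ _ 1 2) => //.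
  exact: contains_compl_copies1.
- apply: (free _ A2_5); apply: contains_trans (embeds_join_compl_copies _ _) _.
  exact: contains_join.
- by apply: (free _ A2_3); rewrite setUC; apply: contains_join.
- by apply: (free _ A2_6); rewrite setUC; apply: contains_join.
- exists (X :|: S), Y; rewrite setUC defT setUAC; split=> //.
  exact: acyclic_almost_stable.
have [leS2|S3] := leqP #|S| 2; first exact: pair_biacyclic.
exfalso; case: c => c.
  apply: (free _ A2_4); rewrite setUC; apply: contains_join => //.
  exact: contains_stable.
(* K_{3,3} joined to three independent vertices is K_{3,3,3}, the complement of 3K_3. *)
apply: (free _ A2_2); apply: (@contains_compl_copiesD _ _ _ 1 2) => //.
exact/contains_compl_copies1/contains_stable.
Qed.

(** C_4 joined to P_3 is the complement of 3K_2 + K_1, and C_4 joined to K_1 + K_2 is itself in the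
    family. *)
Lemma join_C4_three_vertices S T : all_adjacent S T ->
  (forall H, A2 H -> ~ contains (S :|: T) H) ->
  contains S C4 -> contains T 'K_2 -> 2 < #|T| -> ~ contains T 'K_3 -> False.
Proof.
move=> adj free cS eT T3 noK3; have [//|c|c] := contains_three_vertices eT T3.
  by apply: (free _ A2_7); apply: (@contains_compl_copiesD_union _ _ _ 2 1).
by apply: (free _ A2_5); apply: contains_join.
Qed.

(** In a join with an edge on each side, a triangle on either would give K_5, so both sides are
    bipartite. If both have at least three vertices, C_4 is excluded as well and the sides are the
    two forests. *)
Lemma cograph_biacyclic S :
  (forall H, A2 H -> ~ contains S H) -> biacyclic S.
Proof.
move: S; apply: (cograph_ind hG)
  => [|x|S T _ _ _ na IHS IHT|S T S0 T0 adj _ _] free.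
- exists set0, set0; rewrite setU0; split=> //;
    exact/acyclic_stable/stable_set0.
- exists [set x], [set x]; rewrite setUid; split=> //;
    exact/acyclic_stable/stable1.
- apply: coveredU na _ _ (IHS _) (IHT _) => [X Y|X Y|H /free|H /free].
  + exact: acyclicU.
  + exact: acyclicU.
  + by apply: contra_not; apply: contains_sub; apply: subsetUl.
  + by apply: contra_not; apply: contains_sub; apply: subsetUr.
have [stS|eS] := stable_or_edge S; first exact: join_biacyclic.
have adj' := all_adjacent_sym adj.
have [stT|eT] := stable_or_edge T.
  by rewrite setUC in free *; apply: join_biacyclic.
have noK3S : ~ contains S 'K_3.
  by move=> c; apply: (free _ A2_1); apply: (@contains_complete_add _ _ _ 3 2).
have noK3T : ~ contains T 'K_3.
  by move=> c; apply: (free _ A2_1); apply: (@contains_complete_add _ _ _ 2 3).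
have [bS|//] := cograph_bipartite S; have [bT|//] := cograph_bipartite T.
have [S2|S3] := leqP #|S| 2; first exact: pair_biacyclic.
have [T2|T3] := leqP #|T| 2; first by rewrite setUC; apply: pair_biacyclic.
have [acS|//|c] := cograph_acyclic S; last first.
  by case: (join_C4_three_vertices adj free).
have [acT|//|c] := cograph_acyclic T; first by exists S, T.
by rewrite setUC in free; case: (join_C4_three_vertices adj' free).
Qed.

End Cographs.

(** * Two-colourings of the members of the family *)

Definition monochromatic_cycle (H : sgraph) (c : H -> bool) : Prop :=
  exists s : seq H, [/\ ucycle (@edge H) s, 2 < size s & constant (map c s)].

(* The short cycle is v a b or v a d b. *)
Definition closes_short_cycle (H : sgraph) (A : seq H) (v : H) : bool :=
  has (fun a => edge v a && has (fun b => edge b v && (edge a b ||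
    (a != b) && has (fun d => [&& edge a d, edge d b & d != v]) A)) A) A.

(* A and B are the colour classes of the vertices treated so far. *)
Fixpoint uncolorable (H : sgraph) (vs A B : seq H) : bool :=
  if vs is v :: vs' then
    (closes_short_cycle A v || uncolorable vs' (v :: A) B)
      && (closes_short_cycle B v || uncolorable vs' A (v :: B))
  else false.

Lemma closes_short_cycleP (H : sgraph) (A : seq H) v (c : H -> bool) :
  {in A, forall a, c a = c v} -> closes_short_cycle A v ->
  monochromatic_cycle c.
Proof.
move=> cA /hasP[a aA /andP[va /hasP[b bA /andP[bv /orP[ab|]]]]].
  exists [:: v; a; b]; split; rewrite //= ?cA // ?eqxx //.
  by rewrite /ucycle /= va ab bv !inE negb_or !edge_neq // edge_sym.
case/andP=> a_b /hasP[d dA /and3P[ad db dv]].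
exists [:: v; a; d; b]; split; rewrite //= ?cA // ?eqxx //.
rewrite /ucycle /= va ad db bv !inE !negb_or a_b (eq_sym v d) dv.
by rewrite (edge_neq va) (edge_neq ad) (edge_neq db) (eq_sym v b) (edge_neq bv).
Qed.

(** The colouring [c] selects one branch of the search. The empty list answers [false], so success
    means that a monochromatic cycle closes along that branch. *)
Lemma uncolorableP (H : sgraph) (vs A B : seq H) (c : H -> bool) :
  {in A, forall a, c a} -> {in B, forall b, ~~ c b} ->
  uncolorable vs A B -> monochromatic_cycle c.
Proof.
elim: vs A B => //= v vs IH A B cA cB /andP[hA hB].
have [cv|ncv] := boolP (c v).
  case/orP: hA => [|hA].
    by apply: closes_short_cycleP => a /cA ->; rewrite cv.
  by apply: IH hA => // a; rewrite inE => /orP[/eqP->|/cA].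
case/orP: hB => [|hB].
  by apply: closes_short_cycleP => b /cB /negbTE ->; rewrite (negbTE ncv).
by apply: IH hB => // b; rewrite inE => /orP[/eqP->|/cB].
Qed.

(* [enum 'I_n] does not reduce to a list of constructors. *)
Fixpoint ords n : seq 'I_n :=
  if n is n'.+1 then ord0 :: map (lift ord0) (ords n') else [::].

Definition sum_vs (A B : Type) (s : seq A) (t : seq B) : seq (A + B) :=
  map inl s ++ map inr t.

Definition copies_vs (A : Type) n (s : seq A) : seq ('I_n * A) :=
  [seq (i, x) | i <- ords n, x <- s].

Lemma A2_uncolorable (H : sgraph) :
  A2 H -> exists vs : seq H, uncolorable vs [::] [::].
Proof.
(* [lazy] rather than [vm_compute]: the pruning of the search relies on [&&]
   and [||] not evaluating their second argument needlessly. *)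
pose c4 := copies_vs 2 (ords 2); case.
- by exists (ords 5); lazy.
- by exists (copies_vs 3 (ords 3)); lazy.
- by exists (sum_vs (copies_vs 2 (ords 3)) (ords 2)); lazy.
- by exists (sum_vs (copies_vs 2 c4) (ords 3)); lazy.
- by exists (sum_vs c4 (sum_vs (ords 1) (ords 2))); lazy.
- by exists (sum_vs (sum_vs c4 (ords 3)) (ords 2)); lazy.
- by exists (sum_vs (copies_vs 3 (ords 2)) (ords 1)); lazy.
Qed.

(** [H] is coloured by membership of the image in [X]. A monochromatic cycle is mapped to a cycle of
    [G] inside [X], or outside [X] and hence inside [Y]. *)
Lemma biacyclic_A2_free (G H : sgraph) :
  biacyclic [set: G] -> A2 H -> ~ embeds H G.
Proof.
move=> [X [Y [defG acX acY]]] /A2_uncolorable[vs unc] [f [fi fE _]].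
have [//|//|s [/andP[cyc un] s3 cs]] :=
  @uncolorableP H vs [::] [::] (fun x => f x \in X) _ _ unc.
have cfs : ucycle (@edge G) (map f s).
  rewrite /ucycle map_inj_uniq // un andbT cycle_map.
  by rewrite (eq_cycle (e' := @edge H)) // => x y; apply: fE.
have [fX|fY] : {subset map f s <= X} \/ {subset map f s <= Y}.
- case: s cs {cyc un s3 cfs} => [|x s]; first by left.
  move=> cs; have {}cs : {in x :: s, forall y, (f y \in X) = (f x \in X)}.
    move=> y; rewrite inE => /orP[/eqP-> //|ys].
    by apply/eqP; move/allP: cs; apply; apply: map_f.
  have [xX|nxX] := boolP (f x \in X).
    by left=> _ /mapP[y /cs fy ->]; rewrite fy.
  right=> _ /mapP[y /cs fy ->]; have : f y \in [set: G] by rewrite inE.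
  by rewrite defG inE fy (negbTE nxX).
- by have := acX _ cfs fX; rewrite size_map ltnNge s3.
- by have := acY _ cfs fY; rewrite size_map ltnNge s3.
Qed.

(** * Vertex arboricity and covers by two acyclic sets *)

Lemma forest_inducedP (G : sgraph) (A : {set G}) :
  forest (induced A) <-> acyclic A.
Proof.
split=> [/forestP fA c /andP[cyc un] cA|acA].
  have [c' defc] : exists c' : seq (induced A), c = map val c'.
    elim: c cA {cyc un} => [|x c IH] cA; first by exists [::].
    have [y yc|c' ->] := IH; first by apply: cA; rewrite inE yc orbT.
    by exists (exist _ x (cA x (mem_head _ _)) :: c').
  rewrite defc size_map; apply: fA.
  by move: cyc un; rewrite defc cycle_map (map_inj_uniq val_inj) /ucycle => ->.
apply/forestP=> c /andP[cyc un]; rewrite -(size_map val c).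
apply: acA; first by rewrite /ucycle cycle_map (map_inj_uniq val_inj) un andbT.
by move=> _ /mapP[x _ ->]; apply: valP.
Qed.

(** A cover refines to the partition into [X] and its complement, which lies in [Y]. Conversely, a
    partition with fewer than two blocks gives a cover by repeating one set. *)
Lemma biacyclicP (G : sgraph) :
  vertex_arboricity G <= 2 <-> biacyclic [set: G].
Proof.
rewrite /vertex_arboricity; case: ex_minnP => m hm minm; split=> [m2|].
  have /existsP[P /and3P[/and3P[/eqP covP _ _] /eqP cP /forall_inP fP]] := hm.
  have ac A : A \in P -> acyclic A by move=> /fP /forest_inducedP.
  have ac0 : acyclic (set0 : {set G}) by apply/acyclic_stable/stable_set0.
  move: m2; rewrite -cP leq_eqVlt ltnS => /orP[/cards2P[A [B [_ defP]]]|].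
    exists A, B; rewrite -covP defP /cover bigcup_setU !big_set1.
    by split=> //; apply: ac; rewrite defP !inE eqxx ?orbT.
  rewrite leq_eqVlt ltnS leqn0 cards_eq0 => /orP[/cards1P[A defP]|/eqP defP].
    exists A, A; rewrite -covP defP /cover big_set1 setUid.
    by split=> //; apply: ac; rewrite defP inE.
  by exists set0, set0; rewrite -covP defP /cover big_set0 setUid.
move=> [X [Y [defG acX acY]]].
(* Blocks of a partition are nonempty, so [set0] is discarded in case [X] or its complement is
   empty. *)
pose P := [set X; ~: X] :\ set0.
have cardP : #|P| <= 2.
  apply: leq_trans (subset_leq_card (subsetDl _ _)) _.
  by rewrite cards2; case: (_ != _).
apply: leq_trans (minm _ _) cardP; apply/existsP; exists P; rewrite eqxx /=.
apply/andP; split; last first.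
  apply/forall_inP=> A; rewrite !inE => /andP[_ /orP[] /eqP->];
    apply/forest_inducedP => //.
  apply: acyclic_sub acY; apply/subsetP=> x; rewrite inE => nxX.
  have : x \in [set: G] by rewrite inE.
  by rewrite defG inE (negbTE nxX).
apply/and3P; split; last by rewrite !inE eqxx.
  apply/eqP/setP=> x; rewrite inE; apply/bigcupP.
  have [xX|nxX] := boolP (x \in X); [exists X|exists (~: X)];
    rewrite // !inE ?eqxx ?orbT ?andbT //.
    by apply/set0Pn; exists x.
  by apply/set0Pn; exists x; rewrite inE.
apply/trivIsetP=> A B; rewrite !inE.
move=> /andP[_ /orP[] /eqP->] /andP[_ /orP[] /eqP->];
  by rewrite ?eqxx // => _; rewrite disjoints_subset ?setCK.
Qed.

Theorem theorem2 (G : sgraph) (hG : cograph G) :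
  vertex_arboricity G <= 2 <-> family_free A2 G.
Proof.
apply: iff_trans (biacyclicP G) _; split=> [bG H AH /has_inducedP|free].
  exact: biacyclic_A2_free.
by apply: cograph_biacyclic => // H AH /has_inducedP; apply: free.
Qed.
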